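(* For every $\mathcal{X}\in\mathbf{SSS}$ the map $\pi_{\mathcal{X}}:T\mathcal{X}\to\mathcal{X}$, $[\gamma]\mapsto\gamma(0)$, is sample-smooth. For sample-smooth $f:\mathcal{X}\to\mathcal{Y}$ the assignment $Tf[\gamma]:=[f\circ\gamma]$ is well defined and sample-smooth, $T$ is an endofunctor of $\mathbf{SSS}$ with $\pi$ natural, and the map $$\mathbb{R}\times T\mathcal{X}\longrightarrow T\mathcal{X},\qquad(\lambda,[\gamma])\longmapsto\lambda\cdot[\gamma]:=[t\mapsto\gamma(\lambda t)],$$ is sample-smooth and restricts to a scalar action on each $T_x\mathcal{X}$ (an action of the multiplicative monoid $\mathbb{R}$) fixing $[\mathrm{const}_x]$.
   Context: **Sample space.** $\Omega=[0,1]^{\mathbb{N}}$; $\mathcal{B}_\Omega$ is the universal completion of its Borel (product) $\sigma$-algebra, i.e. all universally measurable subsets; $\Omega^\Omega$ is the set of all $\mathcal{B}_\Omega$-$\mathcal{B}_\Omega$-measurable self-maps of $\Omega$. **Site.** $\Omega_n:=\mathbb{R}^n\times\Omega$, $n\ge0$. A map $g:\Omega_m\to\mathbb{R}^n$ is mixed-smooth, $g\in\mathcal{C}^\infty_{\mathrm{mix}}(\Omega_m,\mathbb{R}^n)$, if (M1) $g(-,\omega)\in C^\infty(\mathbb{R}^m,\mathbb{R}^n)$ for every $\omega$, and (M2) $g(t,-)$ is $\mathcal{B}_\Omega$-Borel measurable for every $t$. The category $\mathbb{S}$ has objects $\Omega_n$ and morphisms $\mathbb{S}(\Omega_m,\Omega_n)=\{(g,\Phi):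 g\in\mathcal{C}^\infty_{\mathrm{mix}}(\Omega_m,\mathbb{R}^n),\Phi\in\Omega^\Omega\}$, where $(g,\Phi)(t,\omega)=(g(t,\omega),\Phi(\omega))$. **Sample-smooth spaces.** A sample-smooth space is a set $\mathcal{X}$ with, for each $n\ge0$, a set $\mathcal{X}^{\Omega_n}$ of maps $\Omega_n\to\mathcal{X}$ (plots) containing all constant maps and such that $p\in\mathcal{X}^{\Omega_n}$, $h\in\mathbb{S}(\Omega_m,\Omega_n)$ imply $p\circ h\in\mathcal{X}^{\Omega_m}$. A map $f:\mathcal{X}\to\mathcal{Y}$ is sample-smooth (a morphism of $\mathbf{SSS}$) if $f\circ p\in\mathcal{Y}^{\Omega_n}$ for all $n$ and $p\in\mathcal{X}^{\Omega_n}$. Products: $(\prod_i\mathcal{X}_i)^{\Omega_n}=\prod_i\mathcal{X}_i^{\Omega_n}$. $\mathbb{R}^k$ carries the plots $\mathcal{C}^\infty_{\mathrm{mix}}(\Omega_n,\mathbb{R}^k)$; $\mathbf{SSS}(\mathbb{R},\mathbb{R})=C^\infty(\mathbb{R},\mathbb{R})$. Subsets carry the plots of the ambient space with values in them. For a surjection $q:\mathcal{X}\to\mathcal{Q}$ the quotient structure is $\mathcal{Q}^{\Omega_n}=\{\text{constants}\}\cup q\circ\mathcal{X}^{\Omega_n}$. The function space $\mathcal{Y}^{\mathcal{X}}$ is $\mathbf{SSS}(\mathcal{X},\mathcal{Y})$ with plots those $F:\Omega_n\to\mathcal{Y}^{\mathcal{X}}$ such that for all $m$, $h\in\mathbb{S}(\Omega_m,\Omega_n)$,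 $q\in\mathcal{X}^{\Omega_m}$ one has $(u\mapsto F(h(u))(q(u)))\in\mathcal{Y}^{\Omega_m}$. **Tangent bundle.** On the function space $\mathcal{X}^{\mathbb{R}}$ let $\gamma\sim\eta$ iff $\gamma(0)=\eta(0)$ and $(f\circ\gamma)'(0)=(f\circ\eta)'(0)$ for all $f\in\mathbf{SSS}(\mathcal{X},\mathbb{R})$. $T\mathcal{X}:=\mathcal{X}^{\mathbb{R}}/\!\sim$ with the quotient structure; $[\gamma]$ denotes the class of $\gamma$; $T_x\mathcal{X}:=\pi_{\mathcal{X}}^{-1}(x)$ with the subspace structure; $\mathrm{const}_x$ is the constant curve at $x$. *)

(* Defs.v *)
From HB Require Import structures.
From mathcomp Require Import all_boot all_order all_algebra.
From mathcomp Require Import all_classical all_reals all_analysis.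
Set Implicit Arguments.
Unset Strict Implicit.
Unset Printing Implicit Defensive.
Import Order.TTheory GRing.Theory Num.Theory numFieldNormedType.Exports.
Local Open Scope classical_set_scope.
Local Open Scope quotient_scope.
Local Open Scope ring_scope.

(* A is universally measurable if it lies in the P-completion of the sigma-algebra
   of T for every probability P on T. *)
Definition universally_measurable (R : realType) d (T : measurableType d)
    (A : set T) : Prop :=
  forall P : probability T R,
    exists2 B, measurable B & P.-negligible (A `+` B).

Definition univ_display : measure_display -> measure_display.
Proof. exact. Qed.

Definition universal_completion (R : realType) d (T : measurableType d) : Type :=
  T.

Section universal_completion.
Context (R : realType) d (T : measurableType d).
Local Notation umeas := (@universally_measurable R d T).

Lemma universally_measurable0 : umeas set0.
Proof. by move=> P; exists set0 => //; rewrite setYK; exact: negligible_set0. Qed.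

Lemma universally_measurableC A : umeas A -> umeas (~` A).
Proof.
move=> uA P; have [B mB nB] := uA P.
exists (~` B); first exact: measurableC.
by rewrite !setY_def !setDE !setCK setUC (setIC (~` B)) (setIC (~` A)) in nB *.
Qed.

Lemma universally_measurable_bigcup (F : (set T)^nat) :
  (forall i, umeas (F i)) -> umeas (\bigcup_i F i).
Proof.
move=> uF P; have /choice[B BF] : forall i, exists B,
    measurable B /\ P.-negligible (F i `+` B).
  by move=> i; have [B ? ?] := uF i P; exists B.
exists (\bigcup_i B i); first by apply: bigcup_measurable => i _; case: (BF i).
apply: (@negligibleS _ _ _ P (\bigcup_i (F i `+` B i))).
  move=> x [[[i _ Fx] nB]|[[i _ Bx] nF]]; exists i => //.
    by left; split=> // Bx; apply: nB; exists i.
  by right; split=> // Fx; apply: nF; exists i.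
by apply: negligible_bigcup => i; case: (BF i).
Qed.

HB.instance Definition _ := Pointed.on (@universal_completion R d T).
HB.instance Definition _ := isMeasurable.Build (univ_display d)
  (@universal_completion R d T) universally_measurable0
  universally_measurableC universally_measurable_bigcup.
End universal_completion.


Definition hilbert_cube (R : realType) : Type := nat -> `[0%R : R, 1%R]%classic.

Lemma hilbert_cube0_subproof (R : realType) : (0 : R) \in `[0%R : R, 1%R]%classic.
Proof. by rewrite inE /= in_itv /= lexx ler01. Qed.

Definition hilbert_cube0 (R : realType) : hilbert_cube R :=
  fun=> exist _ 0 (hilbert_cube0_subproof R).

HB.instance Definition _ (R : realType) := gen_eqMixin (hilbert_cube R).
HB.instance Definition _ (R : realType) := gen_choiceMixin (hilbert_cube R).
HB.instance Definition _ (R : realType) :=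
  isPointed.Build (hilbert_cube R) (hilbert_cube0 R).

(* The sets [set w | B (w n)] with B Borel generate the product sigma-algebra,
   which is also the Borel sigma-algebra of the product topology. *)
Definition cylinders (R : realType) : set (set (hilbert_cube R)) :=
  [set A | exists n (B : set R),
     measurable B /\ A = [set w | B (set_val (w n))]].

(* The sample space: [0, 1]^nat with the universal completion of its Borel
   sigma-algebra. *)
Definition sample (R : realType) :=
  @universal_completion R _ (g_sigma_algebraType (@cylinders R)).
HB.instance Definition _ (R : realType) := Measurable.on (sample R).

Definition borel (R : realType) (V : normedModType R) :=
  g_sigma_algebraType (@open V).
HB.instance Definition _ (R : realType) (V : normedModType R) :=
  Measurable.on (borel V).

(* C^k maps through iterated directional derivatives; for U finite-dimensional
   (here U is 'rV[R]_m, including m = 0) this is the usual notion: f is Frechet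
   differentiable and its differential is C^(k-1). *)
Section smooth.
Context (R : realType) (U V : normedModType R).

Fixpoint Ck k (f : U -> V) : Prop :=
  if k is k'.+1 then
    (forall x, differentiable f x) /\ forall v, Ck k' ('D_v f)
  else continuous f.

Definition smooth (f : U -> V) := forall k, Ck k f.
End smooth.

Definition site_obj (R : realType) n : Type := ('rV[R]_n * sample R)%type.

Definition mixed_smooth (R : realType) m (V : normedModType R)
    (g : site_obj R m -> V) : Prop :=
  (forall w, smooth (fun t => g (t, w))) /\
  (forall t, measurable_fun [set: sample R] (fun w => g (t, w) : borel V)).

Definition site_map (R : realType) m n
    (h : site_obj R m -> site_obj R n) : Prop :=
  exists (g : site_obj R m -> 'rV[R]_n) (Phi : sample R -> sample R),
    [/\ mixed_smooth g, measurable_fun [set: sample R] Phi &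
        h = fun u => (g u, Phi u.2)].

Section Ck_theory.
Context (R : realType).
Implicit Types U V W : normedModType R.

Lemma derive_comp U V W (f : U -> V) (g : V -> W) x v :
  differentiable f x -> differentiable g (f x) ->
  'D_v (g \o f) x = 'D_('D_v f x) g (f x).
Proof.
move=> df dg; rewrite (deriveE _ df) (deriveE _ dg).
by rewrite (deriveE _ (differentiable_comp df dg)) (diff_comp df dg).
Qed.

Lemma CkS U V k (f : U -> V) :
  Ck k.+1 f <-> (forall x, differentiable f x) /\ forall v, Ck k ('D_v f).
Proof. by []. Qed.

Lemma CkW U V k (f : U -> V) : Ck k.+1 f -> Ck k f.
Proof.
elim: k f => [|k ih] f /CkS[df cf]; first by move=> x; exact: differentiable_continuous.
by apply/CkS; split=> // v; apply: ih.
Qed.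

Lemma Ck_cst U V k (c : V) : Ck k (fun _ : U => c).
Proof.
elim: k c => [|k ih] c; first by move=> x; exact: cvg_cst.
apply/CkS; split=> [x|v]; first exact: differentiable_cst.
rewrite (_ : 'D_v _ = fun=> 0); first by apply: ih.
by apply/funext => x; rewrite derive_cst.
Qed.

Lemma CkD U V k (f g : U -> V) : Ck k f -> Ck k g -> Ck k (f \+ g).
Proof.
elim: k f g => [|k ih] f g.
  by move=> cf cg x; apply: cvgD; [exact: cf|exact: cg].
move=> /CkS[df cf] /CkS[dg cg]; apply/CkS; split=> [x|v]; first exact: differentiableD.
rewrite (_ : 'D_v _ = 'D_v f \+ 'D_v g); first by apply: ih.
apply/funext => x.
exact: deriveD (@diff_derivable _ _ _ f x v (df x))
  (@diff_derivable _ _ _ g x v (dg x)).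
Qed.

Lemma Ck_sum U V k n (f : 'I_n -> U -> V) : (forall i, Ck k (f i)) ->
  Ck k (fun x => \sum_i f i x).
Proof.
move=> cf; rewrite -(_ : \sum_i f i = fun x => \sum_i f i x); last first.
  by apply/funext => x; rewrite fct_sumE.
by elim/big_ind : _ => //; [exact: Ck_cst|exact: CkD].
Qed.

Lemma Ck_lin U V W k (l : {linear V -> W}) (f : U -> V) :
  continuous l -> Ck k f -> Ck k (l \o f).
Proof.
move=> cl; elim: k f => [|k ih] f.
  by move=> cf x; apply: continuous_comp; [exact: cf|exact: cl].
have dl y : differentiable l y by exact: linear_differentiable.
move=> /CkS[df cf]; apply/CkS; split=> [x|v]; first exact: differentiable_comp.
rewrite (_ : 'D_v _ = l \o 'D_v f); first by apply: ih.
by apply/funext => x; rewrite (derive_comp _ (df x) (dl _)) (deriveE _ (dl _)) diff_lin.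
Qed.

Lemma Ck_coord U k n (f : U -> 'rV[R]_n) j :
  Ck k f -> Ck k (fun x => f x 0 j : R).
Proof.
have @l : {linear 'rV[R]_n -> R}.
  by exists (fun N : 'rV[R]_n => N 0 j); do 2![eexists]; do ?[constructor];
     rewrite ?mxE// => ? *; rewrite ?mxE//; move=> ?; rewrite !mxE.
by apply: (Ck_lin (l := l)); exact: coord_continuous.
Qed.

Lemma scale_is_bilinear V :
  bilinear_for
    (GRing.Scale.Law.clone _ _ *:%R _) (GRing.Scale.Law.clone _ _ *:%R _)
    (@GRing.scale R V : R -> V -> V).
Proof.
split=> [u'|u] a x y /=.
- by rewrite scalerDl scalerA.
- by rewrite scalerDr !scalerA mulrC.
Qed.

Lemma Ck_scale U V k (a : U -> R) (f : U -> V) :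
  Ck k a -> Ck k f -> Ck k (fun x => a x *: f x).
Proof.
pose bM := bilinear_isBilinear.Build R R V V _ _ (@GRing.scale R V : R -> V -> V)
  (scale_is_bilinear V).
pose b : {bilinear R -> V -> V} := HB.pack (@GRing.scale R V : R -> V -> V) bM.
have bc : continuous (fun p : R * V => b p.1 p.2).
  by move=> p; exact: scale_continuous.
elim: k a f => [|k ih] a f.
  by move=> ca cf x; apply: cvgZ; [exact: ca|exact: cf].
move=> /[dup] ca /CkS[da ca'] /[dup] cf /CkS[df cf'].
have dp x : differentiable (fun y => (a y, f y)) x.
  exact: differentiable_pair.
have db x : differentiable (fun p : R * V => b p.1 p.2) x.
  exact: differentiable_bilin.
apply/CkS; split=> [x|v].
  exact: (@differentiable_comp _ _ _ _ (fun y => (a y, f y))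
    (fun p : R * V => b p.1 p.2) x (dp x) (db _)).
rewrite (_ : 'D_v _ = (fun x => a x *: 'D_v f x) \+ (fun x => 'D_v a x *: f x)).
  by apply: CkD; apply: ih => //; exact: CkW.
apply/funext => x.
rewrite (@derive_comp _ _ _ (fun y => (a y, f y))
  (fun p : R * V => b p.1 p.2) x v (dp x) (db _)) (deriveE _ (db _)) diff_bilin //.
by rewrite (deriveE _ (dp _)) (diff_pair (da x) (df x)) /= (deriveE _ (da x)) (deriveE _ (df x)).
Qed.

Lemma Ck_comp U V k n (f : U -> 'rV[R]_n) (g : 'rV[R]_n -> V) :
  Ck k f -> Ck k g -> Ck k (g \o f).
Proof.
elim: k V f g => [|k ih] V f g.
  by move=> cf cg x; apply: continuous_comp; [exact: cf|exact: cg].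
move=> /[dup] cf /CkS[df cf'] /[dup] cg /CkS[dg cg'].
apply/CkS; split=> [x|v]; first exact: differentiable_comp.
rewrite (_ : 'D_v _ = fun x => \sum_(j < n)
    ('D_v f x 0 j : R) *: ('D_(delta_mx 0 j) g \o f) x).
  apply: Ck_sum => j; apply: Ck_scale; first exact: Ck_coord.
  by apply: ih => //; exact: CkW.
apply/funext => x; rewrite (derive_comp _ (df x) (dg _)) (deriveE _ (dg _)).
rewrite {1}(row_sum_delta ('D_v f x)) linear_sum; apply: eq_bigr => j _.
by rewrite linearZ /= (deriveE _ (dg _)).
Qed.

Lemma smooth_comp U V n (f : U -> 'rV[R]_n) (g : 'rV[R]_n -> V) :
  smooth f -> smooth g -> smooth (g \o f).
Proof. by move=> cf cg k; exact: Ck_comp. Qed.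

End Ck_theory.

Section measurability.
Context (R : realType).

Lemma open_borel (V : normedModType R) (U : set V) :
  open U -> measurable (U : set (borel V)).
Proof. by move=> oU; exact: sub_gen_smallest. Qed.

Lemma measurable_borelP d (T : measurableType d) (V : normedModType R)
    (f : T -> borel V) :
  (forall U : set V, open U -> measurable (f @^-1` U)) ->
  measurable_fun setT f.
Proof.
move=> mf; apply: (@measurability _ _ T (borel V) setT f (@open V)) => // _ [U oU <-].
by rewrite setTI; exact: mf.
Qed.

Lemma dense_ratr_row n (x : 'rV[R]_n) (e : R) : 0 < e ->
  exists q : 'rV[rat]_n, ball (map_mx ratr q : 'rV[R]_n) e x.
Proof.
move=> e0.
have /choice[q xq] : forall j : 'I_n, exists q : rat, ball (ratr q : R) e (x 0 j).
  move=> j; have /rat_in_itvoo[q] : x 0 j < x 0 j + e by rewrite ltrDl.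
  rewrite in_itv /= => /andP[xq qx]; exists q.
  by rewrite /ball /= ger0_norm ?subr_ge0 ?(ltW xq)// ltrBlDl.
by exists (\row_j q j); split=> // i j; rewrite !mxE ord1.
Qed.

Lemma measurable_caratheodory d (T : measurableType d) n (V : normedModType R)
    (g : 'rV[R]_n * T -> V) (f : T -> borel 'rV[R]_n) (Phi : T -> T) :
  (forall w, continuous (fun t => g (t, w))) ->
  (forall t, measurable_fun setT (fun w => g (t, w) : borel V)) ->
  measurable_fun setT f -> measurable_fun setT Phi ->
  measurable_fun setT (fun w => g (f w, Phi w) : borel V).
Proof.
move=> cg mg mf mPhi; apply: measurable_borelP => U oU.
pose r (k : nat) : R := k.+1%:R^-1.
have r0 k : 0 < r k by rewrite invr_gt0.
have rlt (e : R) : 0 < e -> exists k, r k < e.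
  move=> e0; have [k _ /(_ k (leqnn k)) ke] := near_infty_natSinv_lt (PosNum e0).
  by exists k.
pose Us k := [set y : V | ball y (r k) `<=` U].
have mUs k : measurable (Us k : set (borel V)).
  rewrite -[Us k]setCK; apply: measurableC; apply: open_borel.
  rewrite openE => y /= /existsNP[z /not_implyP[yz nUz]].
  apply/nbhs_ballP; exists (r k - `|y - z|) => /=.
    by rewrite subr_gt0; move: yz; rewrite -ball_normE.
  move=> y' yy' /(_ z); apply/not_implyP; split=> //.
  move: yy' yz; rewrite -!ball_normE /= ltrBrDr => yy' _.
  apply: le_lt_trans yy'; rewrite (distrC y y').
  by rewrite (le_trans _ (ler_normD _ _))// addrA subrK.
pose Q (q : 'rV[rat]_n) : 'rV[R]_n := map_mx ratr q.
rewrite (_ : _ @^-1` U = \bigcup_j \bigcap_k \bigcup_q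
    (f @^-1` ball (Q q) (r k) `&` (fun w => g (Q q, Phi w)) @^-1` Us j)).
  apply: bigcupT_measurable => j; apply: bigcapT_measurable => k.
  apply: countable_bigcupT_measurable => [|q]; first exact: countableP.
  apply: measurableI.
    rewrite -[X in measurable X]setTI; apply: mf => //.
    by apply: open_borel; exact: ball_open.
  rewrite -[X in measurable X]setTI.
  have mgq := measurableT_comp (mg (Q q)) mPhi.
  by apply: mgq => //; exact: mUs.
apply/seteqP; split=> w /=.
  move=> Uw.
  have /nbhs_ballP[e /= e0 eU] : nbhs (g (f w, Phi w)) U by exact: open_nbhs_nbhs.
  have [j je] := rlt _ (divr_gt0 e0 (ltr0n R 2)).
  exists j => // k _.
  have e2 : 0 < e / 2 by rewrite divr_gt0.
  have /nbhs_ballP[d' /= d0 dU] : \forall t \near (f w : 'rV[R]_n),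
      ball (g (f w, Phi w)) (e / 2) (g (t, Phi w)).
    by apply: (cg (Phi w) (f w)); exact: nbhsx_ballx.
  have dr0 : 0 < Num.min d' (r k) by rewrite lt_min d0 r0.
  have [q qf] := dense_ratr_row (f w) dr0.
  exists q => //; split => /=.
    by apply: le_ball qf; rewrite ge_min lexx orbT.
  move=> z gz; apply: eU; rewrite (splitr e).
  apply: ball_triangle (le_ball (ltW je) gz); apply: dU.
  by apply: ball_sym; apply: le_ball qf; rewrite ge_min lexx.
move=> [j _ jP].
have /nbhs_ballP[d' /= d0 dU] : \forall t \near (f w : 'rV[R]_n),
    ball (g (f w, Phi w)) (r j) (g (t, Phi w)).
  by apply: (cg (Phi w) (f w)); exact: nbhsx_ballx.
have [k kd] := rlt _ d0.
have [q _ [/= qf Uq]] := jP k I.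
apply: Uq; apply: ball_sym; apply: dU; apply: ball_sym.
exact: le_ball (ltW kd) _ qf.
Qed.

End measurability.

Lemma mixed_smooth_comp (R : realType) m n (V : normedModType R)
    (g : site_obj R n -> V) (h : site_obj R m -> site_obj R n) :
  mixed_smooth g -> site_map h -> mixed_smooth (g \o h).
Proof.
move=> [sg mg] [f [Phi [[sf mf] mPhi ->]]]; split=> [w|t] /=.
  by apply: (smooth_comp (sf w) (sg (Phi w))).
apply: (@measurable_caratheodory _ _ _ _ _ g (fun w => f (t, w)) Phi) => // w.
exact: (sg w 0).
Qed.

Lemma site_map_comp (R : realType) l m n
    (h : site_obj R m -> site_obj R n) (k : site_obj R l -> site_obj R m) :
  site_map h -> site_map k -> site_map (h \o k).
Proof.
move=> [g [Phi [sg mPhi ->]]] sk.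
have sgk := mixed_smooth_comp sg sk.
move: sk => [f [Psi [sf mPsi ek]]].
exists (g \o k), (Phi \o Psi); split=> //; last by rewrite ek.
exact: measurableT_comp.
Qed.

Record sss (R : realType) := Sss {
  sss_car :> Type;
  plot : forall n, set (site_obj R n -> sss_car);
  plot_cst : forall n x, plot (fun _ : site_obj R n => x);
  plot_comp : forall m n (p : site_obj R n -> sss_car)
    (h : site_obj R m -> site_obj R n),
    plot p -> site_map h -> plot (p \o h) }.
Arguments plot {R} s n : rename.

Definition sample_smooth (R : realType) (X Y : sss R) (f : X -> Y) : Prop :=
  forall n (p : site_obj R n -> X), plot X n p -> plot Y n (f \o p).

Record sss_hom (R : realType) (X Y : sss R) := SssHom {
  hom_fun :> X -> Y;
  hom_smooth : sample_smooth hom_fun }.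

Section sss_constructions.
Context (R : realType).
Implicit Types X Y Z : sss R.

Lemma sample_smooth_id X : @sample_smooth R X X id.
Proof. by []. Qed.

Lemma sample_smooth_comp X Y Z (g : sss_hom Y Z) (f : sss_hom X Y) :
  @sample_smooth R X Z (g \o f).
Proof. by move=> n p pp; apply: (hom_smooth g); exact: (hom_smooth f). Qed.

Lemma sample_smooth_cst X Y (y : Y) : @sample_smooth R X Y (fun=> y).
Proof. by move=> n p _; exact: plot_cst. Qed.

Definition hom_id X : sss_hom X X := SssHom (@sample_smooth_id X).
Definition hom_comp X Y Z (g : sss_hom Y Z) (f : sss_hom X Y) : sss_hom X Z :=
  SssHom (sample_smooth_comp g f).
Definition hom_cst X Y (y : Y) : sss_hom X Y := SssHom (@sample_smooth_cst X Y y).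

Lemma mixed_smooth_cst n (x : R) : mixed_smooth (fun _ : site_obj R n => x).
Proof. by split=> [w k|t]; [exact: Ck_cst|exact: measurable_cst]. Qed.

(* The target is R itself rather than 'rV[R]_1. *)
Definition real_line : sss R := Sss mixed_smooth_cst
  (fun m n p h => @mixed_smooth_comp R m n R p h).

Section product.
Context (X Y : sss R).

Definition prod_plot n : set (site_obj R n -> X * Y) :=
  [set p | plot X n (fst \o p) /\ plot Y n (snd \o p)].

Lemma prod_plot_cst n x : prod_plot (fun _ : site_obj R n => x).
Proof. by split; exact: plot_cst. Qed.

Lemma prod_plot_comp m n (p : site_obj R n -> X * Y)
    (h : site_obj R m -> site_obj R n) :
  prod_plot p -> site_map h -> prod_plot (p \o h).
Proof. by move=> [p1 p2] sh; split; [exact: plot_comp p1 sh|exact: plot_comp p2 sh]. Qed.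

Definition sss_prod : sss R := Sss prod_plot_cst prod_plot_comp.
End product.

Section subspace.
Context (X : sss R) (A : set X).

Definition sub_plot n : set (site_obj R n -> A) :=
  [set p | plot X n (set_val \o p)].

Lemma sub_plot_cst n x : sub_plot (fun _ : site_obj R n => x).
Proof. exact: plot_cst. Qed.

Lemma sub_plot_comp m n (p : site_obj R n -> A)
    (h : site_obj R m -> site_obj R n) :
  sub_plot p -> site_map h -> sub_plot (p \o h).
Proof. exact: plot_comp. Qed.

Definition sss_sub : sss R := Sss sub_plot_cst sub_plot_comp.
End subspace.

(* Intended for a surjective q; adding the constant maps explicitly makes sense
   for any q. *)
Section quotient.
Context (X : sss R) (Q : Type) (q : X -> Q).

Definition quot_plot n : set (site_obj R n -> Q) :=
  [set p | (exists c, p = fun=> c) \/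
           (exists2 p', plot X n p' & p = q \o p')].

Lemma quot_plot_cst n x : quot_plot (fun _ : site_obj R n => x).
Proof. by left; exists x. Qed.

Lemma quot_plot_comp m n (p : site_obj R n -> Q)
    (h : site_obj R m -> site_obj R n) :
  quot_plot p -> site_map h -> quot_plot (p \o h).
Proof.
move=> [[c ->]|[p' pp' ->]] sh; first by left; exists c.
by right; exists (p' \o h) => //; exact: plot_comp.
Qed.

Definition sss_quot : sss R := Sss quot_plot_cst quot_plot_comp.
End quotient.

Section function_space.
Context (X Y : sss R).

Definition exp_plot n : set (site_obj R n -> sss_hom X Y) :=
  [set F | forall m (h : site_obj R m -> site_obj R n) (q : site_obj R m -> X),
    site_map h -> plot X m q -> plot Y m (fun u => F (h u) (q u))].

Lemma exp_plot_cst n f : exp_plot (fun _ : site_obj R n => f).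
Proof. by move=> m h q _; exact: hom_smooth. Qed.

Lemma exp_plot_comp m n (F : site_obj R n -> sss_hom X Y)
    (h : site_obj R m -> site_obj R n) :
  exp_plot F -> site_map h -> exp_plot (F \o h).
Proof.
by move=> pF sh l k q sk pq; exact: (pF _ (h \o k) q (site_map_comp sh sk) pq).
Qed.

Definition sss_exp : sss R := Sss exp_plot_cst exp_plot_comp.
End function_space.

Lemma mul_sample_smooth (a : R) :
  @sample_smooth R real_line real_line (fun t => a * t : R).
Proof.
move=> n p [sp mp]; split=> [w k|t].
  exact: (@Ck_scale R _ R k (fun=> a) _ (@Ck_cst R _ R k a) (sp w k)).
apply: measurable_borelP => U oU.
rewrite -[X in measurable X]setTI.
have oaU : open ((fun x : R => a * x) @^-1` U).
  by apply: open_comp => // x _; exact: mulrl_continuous.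
exact: (mp t measurableT _ (open_borel oaU)).
Qed.

Definition mul_hom (a : R) : sss_hom real_line real_line :=
  SssHom (mul_sample_smooth a).

Section tangent.
Context (X : sss R).

Definition tangent_rel (g h : sss_hom real_line X) : bool :=
  `[< g (0 : R) = h (0 : R) /\ forall f : sss_hom X real_line,
        derive1 (fun t : R => f (g t) : R) 0 =
        derive1 (fun t : R => f (h t) : R) 0 >].

Lemma tangent_rel_refl : reflexive tangent_rel.
Proof. by move=> g; apply/asboolP. Qed.

Lemma tangent_rel_sym : symmetric tangent_rel.
Proof.
by move=> g h; apply/asboolP/asboolP => -[-> gh]; split=> // f; rewrite gh.
Qed.

Lemma tangent_rel_trans : transitive tangent_rel.
Proof.
move=> g f h /asboolP[fg0 fg] /asboolP[gh0 gh]; apply/asboolP.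
by split=> [|k]; [rewrite fg0|rewrite fg].
Qed.

Canonical tangent_equiv : equiv_rel {classic (sss_hom real_line X)} :=
  EquivRel tangent_rel tangent_rel_refl tangent_rel_sym tangent_rel_trans.

Definition tangent_car := {eq_quot tangent_equiv}.

Definition tclass (g : sss_hom real_line X) : tangent_car :=
  \pi_(tangent_car) (g : {classic (sss_hom real_line X)}).

Definition tangent : sss R := @sss_quot (sss_exp real_line X) tangent_car tclass.

Definition trepr (v : tangent) : sss_hom real_line X := repr (v : tangent_car).

End tangent.

(* The next three maps act on a chosen representative of the class; that their
   values do not depend on the choice, i.e. that they satisfy the formulas
   [g] |-> g 0, [g] |-> [f \o g] and [g] |-> [t |-> g (a * t)], is a theorem and
   not part of the definitions. *)
Definition tangent_proj X (v : tangent X) : X := trepr v (0 : R).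

Definition tangent_map X Y (f : sss_hom X Y) (v : tangent X) : tangent Y :=
  tclass (hom_comp f (trepr v)).

Definition tangent_scale X (a : R) (v : tangent X) : tangent X :=
  tclass (hom_comp (trepr v) (mul_hom a)).

Definition tangent_fiber X (x : X) : sss R :=
  sss_sub [set v : tangent X | tangent_proj v = x].

Definition scalar_action (T : Type) (act : R -> T -> T) : Prop :=
  (forall v, act 1 v = v) /\
  (forall a b v, act (a * b) v = act a (act b v)).

End sss_constructions.

(* Main.v *)
Require Import Defs.
From mathcomp Require Import all_boot all_order all_algebra.
From mathcomp Require Import all_classical all_reals all_analysis.
Import Order.TTheory GRing.Theory Num.Theory numFieldNormedType.Exports.
Local Open Scope classical_set_scope.
Local Open Scope ring_scope.

(** A plot of [tangent X] is, up to the quotient map, a plot of the function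
    space of curves: a constant plot lifts as well, through a representative of
    its value.  All three operations are induced by operations on curves, namely
    evaluation at 0, postcomposition with [f] and precomposition with
    multiplication by [a].  Smoothness is therefore checked on curves, where it
    is immediate from the definition of the function space as soon as
    [(a, t) |-> a * t] is known to preserve plots of the real line
    ([mixed_smoothM]).

    That the operations respect the tangency relation is clear for the first
    two, because [k \o f] is a test function on [X] when [k] is one on [Y].  For
    the scaling it is the chain rule
    [(k \o g \o (a * _))^`() 0 = a * (k \o g)^`() 0], which requires [k \o g] to
    be differentiable.  It is, because sample-smooth endomaps of the real line
    are differentiable in the ordinary sense ([hom_real_derivable]): testing on
    the plot [(t, w) |-> t] recovers the map itself.

    The remaining identities hold on the level of curves, hence on classes. *)

(** * Plots of the real line *)

Section plots.
Context {R : realType}.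

Lemma Ck_id (U : normedModType R) k : Ck k (@idfun U).
Proof.
case: k => [|k]; first by move=> x; exact: cvg_id.
apply/CkS; split=> // v.
rewrite (_ : 'D_v _ = fun=> v); first exact: Ck_cst.
by apply/funext => x; rewrite derive_id.
Qed.

Lemma site_map_id n : site_map (@idfun (site_obj R n)).
Proof.
exists fst, idfun; split.
- by split=> [w k|t]; [exact: Ck_id|exact: measurable_cst].
- exact: measurable_id.
- by apply/funext => -[].
Qed.

Lemma plot_coord : plot (real_line R) 1 (fun u => u.1 0 0).
Proof.
split=> [w k|t]; last exact: measurable_cst.
by apply: (@Ck_coord R _ k _ idfun); exact: Ck_id.
Qed.

(** Composing [f] with the plot [plot_coord] gives a smooth function of a row
    vector of length 1; restricting it along the linear embedding
    [y |-> y *: const_mx 1] of the line gives back [f]. *)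
Lemma hom_real_derivable (f : sss_hom (real_line R) (real_line R)) (x : R) :
  derivable (f : R -> R) x 1.
Proof.
have [sf _] := hom_smooth f plot_coord.
have [df _] := sf point 1%N.
pose l (y : R) : 'rV[R]_1 := y *: const_mx 1.
have -> : (f : R -> R) = (fun t : 'rV[R]_1 => f (t 0 0)) \o l.
  by apply/funext => y; rewrite /= !mxE mulr1.
apply: diff_derivable; apply: differentiable_comp; last exact: df.
exact: differentiableZl.
Qed.

(** Smoothness in the first variable is the product rule.  For measurability,
    [(s, w) |-> s * b (t, w)] is continuous in [s] and measurable in [w], hence a
    Caratheodory function, and stays measurable when the measurable function
    [w |-> a (t, w)] is substituted for [s]. *)
Lemma mixed_smoothM n (a b : site_obj R n -> R) :
  mixed_smooth a -> mixed_smooth b -> mixed_smooth (fun u => a u * b u).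
Proof.
move=> [sa ma] [sb mb]; split=> [w k|t].
  exact: (@Ck_scale R _ R k _ _ (sa w k) (sb w k)).
pose g (u : 'rV[R]_1 * sample R) : R := u.1 0 0 * b (t, u.2).
pose f w : 'rV[R]_1 := a (t, w) *: const_mx 1.
rewrite (_ : (fun w => _) = fun w => g (f w, idfun w)); last first.
  by apply/funext => w; rewrite /g /f /= !mxE mulr1.
apply: (@measurable_caratheodory R _ (sample R) 1 R g f idfun).
- move=> w.
  apply: (@Ck_scale R _ R 0 (fun s : 'rV[R]_1 => s 0 0) (fun=> b (t, w))).
    by apply: (@Ck_coord R _ 0 _ idfun); exact: Ck_id.
  exact: Ck_cst.
- move=> s.
  have pb : plot (real_line R) n b by [].
  by have [_] := mul_sample_smooth (s 0 0) pb; apply.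
- apply: measurable_borelP => U oU; rewrite -[X in measurable X]setTI.
  have oV : open ((fun x : R => x *: const_mx 1 : 'rV[R]_1) @^-1` U).
    by apply: open_comp => // x _; exact: scalel_continuous.
  exact: (ma t measurableT _ (open_borel oV)).
- exact: measurable_id.
Qed.

End plots.

(** * Tangent classes and curves *)

Section tangent.
Set Implicit Arguments.
Unset Strict Implicit.
Context {R : realType}.
Implicit Types X Y Z : sss R.
Local Notation line := (real_line R).

Lemma sss_hom_ext X Y (f g : sss_hom X Y) : (forall x, f x = g x) -> f = g.
Proof.
case: f g => [f sf] [g sg] /= /funext fg.
by case: _ / fg in sg *; congr SssHom; exact: Prop_irrelevance.
Qed.

Lemma tclassP X (g h : sss_hom line X) :
  reflect (tclass g = tclass h) (tangent_rel g h).
Proof. by apply: (iffP idP) => [gh|/eqmodP//]; exact/eqmodP. Qed.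

Lemma treprK X (v : tangent X) : tclass (trepr v) = v.
Proof. exact: reprK. Qed.

Lemma tangent_rel_trepr X (g : sss_hom line X) :
  tangent_rel (trepr (tclass g)) g.
Proof. by apply/tclassP; rewrite treprK. Qed.

(** The quotient structure adds constant plots by hand, but [tclass] is
    surjective, so they need no separate treatment: they lift to constant plots
    of curves. *)
Lemma tangent_plot_lift X n (p : site_obj R n -> tangent X) :
  plot (tangent X) n p ->
  exists2 F, plot (sss_exp line X) n F & p = @tclass R X \o F.
Proof.
move=> [[c ->]|[F pF ->]]; last by exists F.
exists (fun=> trepr c); first exact: plot_cst.
by apply/funext => u; rewrite /= treprK.
Qed.

Lemma exp_plot_eval X Y n (F : site_obj R n -> sss_hom X Y) q :
  plot (sss_exp X Y) n F -> plot X n q -> plot Y n (fun u => F u (q u)).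
Proof. by move=> pF; exact: (pF n idfun q (site_map_id n)). Qed.

(** Test functions on [Y] pull back along [f] to test functions on [X]. *)
Lemma tangent_rel_comp X Y (f : sss_hom X Y) g h :
  tangent_rel g h -> tangent_rel (hom_comp f g) (hom_comp f h).
Proof.
move=> /asboolP[gh0 gh]; apply/asboolP; split=> [|k]; first by rewrite /= gh0.
exact: (gh (hom_comp k f)).
Qed.

Lemma derive1_scale (f : R -> R) (a : R) : derivable f 0 1 ->
  derive1 (fun t => f (a * t)) 0 = a * derive1 f 0.
Proof.
move=> df; pose m (t : R) := a * t.
have dm : is_derive (0 : R) 1 m (a * 1) by apply: is_deriveZ.
have m0 : m 0 = 0 by rewrite /m mulr0.
rewrite -[LHS]/(derive1 (f \o m) 0) derive1_comp ?m0 //.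
by rewrite mulrC [derive1 m 0]derive1E derive_val mulr1.
Qed.

(** By the chain rule all derivatives along test functions are multiplied by
    the same factor [a], so equality of derivatives is preserved. *)
Lemma tangent_rel_scale X (a : R) (g h : sss_hom line X) :
  tangent_rel g h ->
  tangent_rel (hom_comp g (mul_hom a)) (hom_comp h (mul_hom a)).
Proof.
move=> /asboolP[gh0 gh]; apply/asboolP; split=> [|f] /=.
  by rewrite mulr0.
have dk (k : sss_hom line X) : derivable (fun t : R => f (k t) : R) 0 1.
  exact: (hom_real_derivable (hom_comp f k) 0).
by rewrite (derive1_scale a (dk g)) (derive1_scale a (dk h)) gh.
Qed.

Lemma tangent_projE X (g : sss_hom line X) :
  tangent_proj (tclass g) = g (0 : R).
Proof. by have /asboolP[] := tangent_rel_trepr g. Qed.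

Lemma tangent_mapE X Y (f : sss_hom X Y) (g : sss_hom line X) :
  tangent_map f (tclass g) = tclass (hom_comp f g).
Proof. by apply/tclassP/tangent_rel_comp/tangent_rel_trepr. Qed.

Lemma tangent_scaleE X (a : R) (g : sss_hom line X) :
  tangent_scale a (tclass g) = tclass (hom_comp g (mul_hom a)).
Proof. by apply/tclassP/tangent_rel_scale/tangent_rel_trepr. Qed.

(** * Smoothness of the operations *)

Lemma tangent_proj_smooth X :
  sample_smooth (X := tangent X) (Y := X) (@tangent_proj R X).
Proof.
move=> n p /tangent_plot_lift[F pF ->].
rewrite (_ : _ \o _ = fun u => F u (0 : R)).
  by apply: exp_plot_eval => //; exact: plot_cst.
by apply/funext => u; rewrite /= tangent_projE.
Qed.

Lemma tangent_map_smooth X Y (f : sss_hom X Y) :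
  sample_smooth (X := tangent X) (Y := tangent Y) (tangent_map f).
Proof.
move=> n p /tangent_plot_lift[F pF ->]; right.
exists (fun u => hom_comp f (F u)).
  by move=> m h q sh pq; exact: (hom_smooth f (pF m h q sh pq)).
by apply/funext => u; rewrite /= tangent_mapE.
Qed.

Lemma tangent_scale_smooth X :
  sample_smooth (X := sss_prod line (tangent X)) (Y := tangent X)
    (fun p => tangent_scale p.1 p.2).
Proof.
move=> n p [pa /tangent_plot_lift[F pF eF]]; right.
exists (fun u => hom_comp (F u) (mul_hom (p u).1)).
  move=> m h q sh pq; apply: (pF m h (fun u => (p (h u)).1 * q u) sh).
  (* the curve parameter and the scalar vary together over the plot *)
  exact: mixed_smoothM (plot_comp pa sh) pq.
apply/funext => u; rewrite /= -tangent_scaleE; congr tangent_scale.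
exact: (congr1 (@^~ u) eF).
Qed.

(** * Functoriality and the scalar action *)

Lemma tangent_map_id X : tangent_map (hom_id X) = id.
Proof.
apply/funext => v; rewrite -[v in LHS]treprK tangent_mapE -[RHS]treprK.
by congr tclass; exact: sss_hom_ext.
Qed.

Lemma tangent_map_comp X Y Z (f : sss_hom X Y) (g : sss_hom Y Z) :
  tangent_map (hom_comp g f) = tangent_map g \o tangent_map f.
Proof.
apply/funext => v; rewrite /= -(treprK v) !tangent_mapE.
by congr tclass; exact: sss_hom_ext.
Qed.

Lemma tangent_proj_natural X Y (f : sss_hom X Y) :
  @tangent_proj R Y \o tangent_map f = f \o @tangent_proj R X.
Proof. by apply/funext => v; rewrite /= /tangent_map tangent_projE. Qed.

Lemma tangent_scale_action X : scalar_action (@tangent_scale R X).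
Proof.
split=> [v|a b v]; rewrite -(treprK v) !tangent_scaleE; congr tclass;
  apply: sss_hom_ext => t /=; first by rewrite mul1r.
by rewrite [a * b]mulrC mulrA.
Qed.

Lemma tangent_scale_cst X (a : R) (x : X) :
  tangent_scale a (tclass (hom_cst line x)) = tclass (hom_cst line x).
Proof. by rewrite tangent_scaleE; congr tclass; exact: sss_hom_ext. Qed.

Lemma tangent_proj_scale X (a : R) (v : tangent X) :
  tangent_proj (tangent_scale a v) = tangent_proj v.
Proof. by rewrite /tangent_scale tangent_projE /= mulr0. Qed.

Definition fiber_elt {X} {x : X} {v : tangent X} (vx : tangent_proj v = x) :
  tangent_fiber x := exist _ v (mem_set vx).

Lemma fiberP X (x : X) (v : tangent_fiber x) : tangent_proj (set_val v) = x.
Proof. by case: v => v /= vx; exact: set_mem vx. Qed.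

(** Scaling moves no base point, because [a * 0 = 0]; so it restricts to each
    fiber. *)
Definition fiber_scale {X} {x : X} (a : R) (v : tangent_fiber x) :
    tangent_fiber x :=
  fiber_elt (etrans (tangent_proj_scale a (set_val v)) (fiberP v)).

End tangent.

Theorem proposition4p34 (R : realType) :
  (forall X : sss R,
     (forall g : sss_hom (real_line R) X,
        tangent_proj (tclass g) = g (0 : R)) /\
     sample_smooth (X := tangent X) (Y := X) (@tangent_proj R X)) /\
  (forall (X Y : sss R) (f : sss_hom X Y),
     (forall g : sss_hom (real_line R) X,
        tangent_map f (tclass g) = tclass (hom_comp f g)) /\
     sample_smooth (X := tangent X) (Y := tangent Y) (tangent_map f)) /\
  (forall X : sss R, tangent_map (hom_id X) = id) /\
  (forall (X Y Z : sss R) (f : sss_hom X Y) (g : sss_hom Y Z),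
     tangent_map (hom_comp g f) = tangent_map g \o tangent_map f) /\
  (forall (X Y : sss R) (f : sss_hom X Y),
     @tangent_proj R Y \o tangent_map f = f \o @tangent_proj R X) /\
  (forall X : sss R,
     (forall (a : R) (g : sss_hom (real_line R) X),
        tangent_scale a (tclass g) = tclass (hom_comp g (mul_hom a))) /\
     sample_smooth (X := sss_prod (real_line R) (tangent X)) (Y := tangent X)
       (fun p => tangent_scale p.1 p.2) /\
     forall x : X,
       exists (act : R -> tangent_fiber x -> tangent_fiber x)
              (v0 : tangent_fiber x),
         (forall a v, set_val (act a v) = tangent_scale a (set_val v)) /\
         sample_smooth (X := sss_prod (real_line R) (tangent_fiber x))
           (Y := tangent_fiber x) (fun p => act p.1 p.2) /\
         scalar_action act /\
         set_val v0 = tclass (hom_cst (real_line R) x) /\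
         (forall a : R, act a v0 = v0)).
Proof.
split=> [X|]; first by split; [exact: tangent_projE|exact: tangent_proj_smooth].
split=> [X Y f|]; first by split; [exact: tangent_mapE|exact: tangent_map_smooth].
split; first exact: tangent_map_id.
split; first exact: tangent_map_comp.
split; first exact: tangent_proj_natural.
move=> X; split; first exact: tangent_scaleE.
split; first exact: tangent_scale_smooth.
move=> x; exists fiber_scale.
exists (fiber_elt (tangent_projE (hom_cst (real_line R) x))).
have [act1 actM] := tangent_scale_action X.
split=> //; split.
  move=> n p [pa pv].
  exact: (@tangent_scale_smooth R X n (fun u => ((p u).1, set_val (p u).2))).
split.
  by split=> [v|a b v]; apply: val_inj; [exact: act1|exact: actM].
by split=> // a; apply: val_inj; exact: tangent_scale_cst.
Qed.
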